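(* Let $\gamma\ge 0$ and let $f\in \dot H^{-2}(\Omega)\setminus\mathbb{S}_\gamma$ be time-independent. Let $T,\tilde T>0$ and $u_0,\tilde u_0\in L^2(\Omega)\cap\mathbb{S}_{\gamma+1}$, and let $u$, $\tilde u$ be the solutions of problem (P) with source $f$ and initial data $u_0$, $\tilde u_0$ respectively. If $u(T)=\tilde u(\tilde T)$, then $T=\tilde T$ and $u_0=\tilde u_0$.
   Context: Let $\Omega\subset\mathbb{R}^d$ ($d=1,2,3$) be an open bounded smooth domain, $\alpha\in(0,1)$, and $q\in L^\infty(\Omega)$, $q\ge 0$, a fixed known potential. Let $A=-\Delta+q$ with zero Dirichlet boundary condition on $L^2(\Omega)$, with eigenvalues $0<\lambda_1\le\lambda_2\le\dots\to\infty$ (multiplicity counted) and $L^2(\Omega)$-orthonormal eigenfunctions $\{\varphi_n\}$. For $s\ge0$, $\dot H^s(\Omega)=\{v\in L^2(\Omega):\|v\|_{\dot H^s}^2=\sum_n\lambda_n^s(v,\varphi_n)^2<\infty\}$, and $\dot H^{-s}(\Omega)$ is its dual; $(\cdot,\cdot)$ denotes the $L^2$ inner product and the duality pairing. The Mittag-Leffler function is $E_{\alpha,\beta}(z)=\sum_{k\ge0}z^k/\Gamma(k\alpha+\beta)$. Define $F(t)v=\sum_n E_{\alpha,1}(-\lambda_nt^\alpha)(v,\varphi_n)\varphi_n$ and $E(t)v=\sum_n t^{\alpha-1}E_{\alpha,\alpha}(-\lambda_nt^\alpha)(v,\varphi_n)\varphi_n$. Problem (P) is $\partial_t^\alpha u-\Delta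 u+qu=f$ in $\Omega\times(0,\infty)$, $u=0$ on $\partial\Omega$, $u(0)=u_0$, where $\partial_t^\alpha u(t)=\frac1{\Gamma(1-\alpha)}\int_0^t(t-s)^{-\alpha}u'(s)\,ds$ is the Caputo derivative; its solution is $u(t)=F(t)u_0+\int_0^tE(t-s)f(s)\,ds$, which for time-independent $f$ equals $F(t)u_0+A^{-1}(I-F(t))f$. For $\gamma\ge -1$, $\mathbb{S}_\gamma=\{v\in\dot H^{-2}(\Omega):\lim_{n\to\infty}\lambda_n^\gamma|(v,\varphi_n)|=0\}$. *)

(* Defs.v *)
From Stdlib Require Import Reals.
From Coquelicot Require Import Coquelicot.
Open Scope R_scope.

Definition Gamma (x : R) : R :=
  RInt_gen (fun t => Rpower t (x - 1) * exp (- t)) (at_right 0) (Rbar_locally p_infty).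

Definition ML (a b z : R) : R :=
  Series (fun k => z ^ k / Gamma (INR k * a + b)).

(* Spectral data of A = -Delta + q (Dirichlet): eigenvalues lambda_1 <= lambda_2 <= ...,
   indexed from 0 here, positive, tending to infinity (multiplicity counted). *)
Definition dirichlet_spectrum (lam : nat -> R) : Prop :=
  0 < lam 0%nat /\ (forall n, lam n <= lam (S n)) /\ is_lim_seq lam p_infty.

(* An element v of \dot H^s is represented by its coefficient sequence c n = (v, phi_n). *)
Definition in_L2 (c : nat -> R) : Prop := ex_series (fun n => (c n) ^ 2).

Definition in_Hdot_m2 (lam : nat -> R) (c : nat -> R) : Prop :=
  ex_series (fun n => / (lam n) ^ 2 * (c n) ^ 2).

Definition in_S (lam : nat -> R) (g : R) (c : nat -> R) : Prop :=
  in_Hdot_m2 lam c /\ is_lim_seq (fun n => Rpower (lam n) g * Rabs (c n)) 0.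

(* Coefficients of the solution of (P) with time-independent source f at time t > 0:
   u(t) = F(t) u0 + A^{-1} (I - F(t)) f. *)
Definition solP (alpha : R) (lam : nat -> R) (u0 f : nat -> R) (t : R) (n : nat) : R :=
  ML alpha 1 (- lam n * Rpower t alpha) * u0 n
  + / lam n * (1 - ML alpha 1 (- lam n * Rpower t alpha)) * f n.

(* Main.v *)
Require Import Defs.
From Stdlib Require Import Reals Factorial Lra Lia.
From Coquelicot Require Import Coquelicot.
Open Scope R_scope.

(** Comparing the final states at [T <> T'] gives
    [(E(T') - E(T)) f n / lam n = E(T') u0' n - E(T) u0 n] with [E(t) = ML alpha 1 (- lam n t ^ alpha)].
    If [x ML alpha 1 (- x)] is bounded and [x (ML alpha 1 (- p x) - ML alpha 1 (- q x))] is bounded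
    away from zero for [p < q], the decay of [u0] and [u0'] transfers to [f], which is excluded;
    and for [T = T'] positivity of [ML alpha 1] on the negative axis gives [u0 = u0'].

    These properties of [phi x = ML alpha 1 (- x)] are obtained by discretisation: [phi x] is the
    limit, for [mu = x / n ^ alpha], of the coefficient [U_n] of [z ^ n] in
    [(1 - z) ^ (alpha - 1) / (mu + (1 - z) ^ alpha)]. As [1 - (1 - z) ^ alpha] has nonnegative
    coefficients, [U_n] is nonnegative, nonincreasing and convex in [mu], and
    [b_n(1 - alpha) (1 - U_n) <= mu U_n] and [U_n (1 + mu b_n(1 + alpha)) <= 1], where [b_n(c)] is
    the coefficient of [z ^ n] in [(1 - z) ^ (- c)]. In the limit, [phi] is convex and [x phi x]
    lies between two positive constants for large [x], which yields everything above. *)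

(** * The Gamma function on [[1, +oo)] *)

Lemma Rpower_pos (x y : R) : 0 < Rpower x y.
Proof. apply exp_pos. Qed.

Lemma exp_le_mono (x y : R) : x <= y -> exp x <= exp y.
Proof. intros [H | ->]; [left; now apply exp_increasing | lra]. Qed.

Lemma ln_le_sub1 (x : R) : 0 < x -> ln x <= x - 1.
Proof.
  intros Hx. pose proof (exp_ineq1_le (ln x)) as H.
  rewrite exp_ln in H by easy. lra.
Qed.

(** Apply [ln s <= s - 1] at [s = c * t]: this bounds [p * ln t] by [p * c * t] plus a constant, and
    [c] is chosen so that [p * c <= 1/2]. Half of the exponential decay remains. *)
Lemma Rpower_exp_decay (p : R) : 0 <= p ->
  exists C, 0 < C /\
    forall t, 0 < t -> Rpower t p * exp (- t) <= C * exp (- t / 2).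
Proof.
  intros Hp. set (c := / (2 * (p + 1))).
  assert (Hc : 0 < c) by (apply Rinv_0_lt_compat; lra).
  exists (exp (p * (- 1 - ln c))). split; [apply exp_pos |].
  intros t Ht. unfold Rpower. rewrite <- !exp_plus. apply exp_le_mono.
  pose proof (ln_le_sub1 (c * t)) as H.
  rewrite ln_mult in H by easy. specialize (H ltac:(nra)).
  assert (p * c <= / 2).
  { unfold c. rewrite Rinv_mult. apply Rmult_le_reg_r with (p + 1); [lra |].
    field_simplify; lra. }
  nra.
Qed.

Lemma is_derive_Rpower (p t : R) : 0 < t ->
  is_derive (fun x => Rpower x p) t (p * Rpower t (p - 1)).
Proof. intros Ht. apply is_derive_Reals. now apply derivable_pt_lim_power. Qed.

Lemma continuous_Rpower (p t : R) : 0 < t -> continuous (fun x => Rpower x p) t.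
Proof.
  intros Ht. apply @ex_derive_continuous. eexists. now apply is_derive_Rpower.
Qed.

Lemma continuous_exp_opp (t : R) : continuous (fun x => exp (- x)) t.
Proof. apply @ex_derive_continuous. auto_derive. easy. Qed.

Lemma continuous_gamma_integrand (p t : R) : 0 < t ->
  continuous (fun x => Rpower x p * exp (- x)) t.
Proof.
  intros Ht. apply @continuous_mult.
  - now apply continuous_Rpower.
  - apply continuous_exp_opp.
Qed.

Lemma gamma_integrand_pos (p t : R) : 0 < Rpower t p * exp (- t).
Proof. apply Rmult_lt_0_compat; apply exp_pos. Qed.

Lemma ex_RInt_gamma_integrand (p a b : R) : 0 < a -> a <= b ->
  ex_RInt (fun x => Rpower x p * exp (- x)) a b.
Proof.
  intros Ha Hab. apply @ex_RInt_continuous. intros z Hz.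
  apply continuous_gamma_integrand. rewrite Rmin_left in Hz; lra.
Qed.

Lemma at_right_0_le (d : R) : 0 < d -> at_right 0 (fun t => 0 < t <= d).
Proof.
  intros Hd. exists (mkposreal d Hd). intros y Hy Hy0.
  change (Rabs (y + - 0) < d) in Hy. apply Rabs_def2 in Hy. lra.
Qed.

(** The integrand is positive, so its integrals grow with the interval; they are bounded by the
    integral of [C * exp (- t / 2)], hence converge to their supremum. *)
Lemma is_RInt_gen_gamma_sup (p : R) : 0 <= p ->
  exists l, is_RInt_gen (fun t => Rpower t p * exp (- t))
              (at_right 0) (Rbar_locally p_infty) l /\
    forall a b, 0 < a -> a <= b ->
      RInt (fun t => Rpower t p * exp (- t)) a b <= l.
Proof.
  intros Hp. set (f := fun t => Rpower t p * exp (- t)).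
  destruct (Rpower_exp_decay p Hp) as (C & HC & HCb).
  set (E := fun v => exists a b, 0 < a /\ a <= b /\ v = RInt f a b).
  assert (Hbd : forall a b, 0 < a -> a <= b -> RInt f a b <= 2 * C).
  { intros a b Ha Hab.
    assert (HI : is_RInt (fun t => C * exp (- t / 2)) a b
                   (minus (- 2 * C * exp (- b / 2)) (- 2 * C * exp (- a / 2)))).
    { apply (is_RInt_derive (fun t => - 2 * C * exp (- t / 2))).
      - intros x _. auto_derive; [easy | ]. unfold Rdiv. field.
      - intros x _. apply @ex_derive_continuous. auto_derive. easy. }
    apply Rle_trans with (RInt (fun t => C * exp (- t / 2)) a b).
    - apply RInt_le; [easy | now apply ex_RInt_gamma_integrand | eexists; eassumption |].
      intros x Hx. apply HCb. lra.
    - rewrite (is_RInt_unique _ _ _ _ HI).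
      unfold minus, plus, opp; simpl.
      pose proof (exp_pos (- b / 2)).
      assert (exp (- a / 2) <= 1) by (rewrite <- exp_0; apply exp_le_mono; lra).
      nra. }
  destruct (completeness E) as [l [Hub Hlub]].
  - exists (2 * C). intros v (a & b & Ha & Hab & ->). now apply Hbd.
  - exists (RInt f 1 1), 1, 1. repeat split; lra.
  - exists l.
    assert (Hle : forall a b, 0 < a -> a <= b -> RInt f a b <= l).
    { intros a b Ha Hab. apply Hub. now exists a, b. }
    split; [| exact Hle].
    intros P [eps HP].
    assert (exists a b, 0 < a /\ a <= b /\ l - eps < RInt f a b)
      as (a0 & b0 & Ha0 & Hab0 & Hgt).
    { destruct (Classical_Prop.classic
        (exists a b, 0 < a /\ a <= b /\ l - eps < RInt f a b)) as [H | H]; [easy |].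
      exfalso. assert (l <= l - eps).
      { apply Hlub. intros v (a & b & Ha & Hab & ->).
        apply Rnot_lt_le. intros Hv. apply H. now exists a, b. }
      pose proof (cond_pos eps). lra. }
    unfold filtermapi.
    (* Every such [[a, b]] contains [[a0, b0]], so its integral lies between [l - eps] and [l]. *)
    apply (Filter_prod _ _ _ (fun t => 0 < t <= a0) (fun t => b0 < t)).
    + now apply at_right_0_le.
    + exists b0. easy.
    + intros a b Ha Hb. simpl. exists (RInt f a b). split.
      * apply (RInt_correct f). apply ex_RInt_gamma_integrand; lra.
      * apply HP. change (Rabs (RInt f a b + - l) < eps).
        assert (RInt f a0 b0 <= RInt f a b).
        { rewrite <- (RInt_Chasles f a a0 b), <- (RInt_Chasles f a0 b0 b);
            try (apply ex_RInt_gamma_integrand; lra).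
          assert (0 <= RInt f a a0).
          { apply RInt_ge_0; [lra | apply ex_RInt_gamma_integrand; lra |].
            intros; left; apply gamma_integrand_pos. }
          assert (0 <= RInt f b0 b).
          { apply RInt_ge_0; [lra | apply ex_RInt_gamma_integrand; lra |].
            intros; left; apply gamma_integrand_pos. }
          unfold plus; simpl. lra. }
        assert (RInt f a b <= l) by (apply Hle; lra).
        apply Rabs_def1; lra.
Qed.

Lemma is_RInt_gen_Gamma (x : R) : 1 <= x ->
  is_RInt_gen (fun t => Rpower t (x - 1) * exp (- t))
    (at_right 0) (Rbar_locally p_infty) (Gamma x).
Proof.
  intros Hx. unfold Gamma. apply (@RInt_gen_correct R_CompleteNormedModule);
    try apply Proper_StrongProper; try apply _.
  destruct (is_RInt_gen_gamma_sup (x - 1)) as (l & Hl & _); [lra |].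
  now exists l.
Qed.

Lemma RInt_le_Gamma (x a b : R) : 1 <= x -> 0 < a -> a <= b ->
  RInt (fun t => Rpower t (x - 1) * exp (- t)) a b <= Gamma x.
Proof.
  intros Hx Ha Hab.
  destruct (is_RInt_gen_gamma_sup (x - 1)) as (l & Hl & Hle); [lra |].
  unfold Gamma. rewrite (is_RInt_gen_unique _ _ Hl). now apply Hle.
Qed.

(** A crude Stirling bound: on [[y, y + 1]] the integrand is at least [y ^ y * exp (- y - 1)]. *)
Lemma Gamma_lower (y : R) : 0 < y -> exp (- 1) * Rpower (y * exp (- 1)) y <= Gamma (y + 1).
Proof.
  intros Hy. eapply Rle_trans; [| apply (RInt_le_Gamma (y + 1) y (y + 1)); lra].
  replace (y + 1 - 1) with y by ring.
  assert (Hc : is_RInt (fun _ : R => exp (- 1) * Rpower (y * exp (- 1)) y) y (y + 1)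
                 (scal (y + 1 - y) (exp (- 1) * Rpower (y * exp (- 1)) y)))
    by apply @is_RInt_const.
  apply Rle_trans with (RInt (fun _ : R => exp (- 1) * Rpower (y * exp (- 1)) y) y (y + 1)).
  - rewrite (is_RInt_unique _ _ _ _ Hc). unfold scal; simpl. unfold mult; simpl. right; ring.
  - apply RInt_le; [lra | eexists; eassumption | apply ex_RInt_gamma_integrand; lra |].
    intros t Ht. unfold Rpower. rewrite <- !exp_plus. apply exp_le_mono.
    rewrite ln_mult, ln_exp by (try apply exp_pos; easy).
    assert (ln y <= ln t) by (apply ln_le; lra). nra.
Qed.

Lemma Gamma_pos (x : R) : 1 <= x -> 0 < Gamma x.
Proof.
  intros Hx. apply Rlt_le_trans with (RInt (fun t => Rpower t (x - 1) * exp (- t)) 1 2).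
  - apply RInt_gt_0; [lra | |].
    + intros; apply gamma_integrand_pos.
    + intros; apply continuous_gamma_integrand; lra.
  - apply RInt_le_Gamma; lra.
Qed.

Lemma filterlim_squeeze_0 (F : (R -> Prop) -> Prop) {FF : Filter F} (h k : R -> R) :
  F (fun t => 0 <= h t <= k t) -> filterlim k F (locally 0) ->
  filterlim h F (locally 0).
Proof.
  intros Hle Hk P [eps HP].
  assert (Hk' : F (fun t => Rabs (k t) < eps)).
  { apply (Hk (fun v => Rabs v < eps)). exists eps. intros y Hy.
    change (Rabs (y + - 0) < eps) in Hy. now rewrite Ropp_0, Rplus_0_r in Hy. }
  unfold filtermap. generalize (filter_and _ _ Hle Hk'). apply filter_imp.
  intros t [[H1 H2] H3]. apply HP. change (Rabs (h t + - 0) < eps).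
  rewrite Ropp_0, Rplus_0_r, Rabs_pos_eq by easy.
  apply Rle_lt_trans with (k t); [easy |].
  now rewrite Rabs_pos_eq in H3 by lra.
Qed.

Lemma filterlim_Rpower_exp_0 (p : R) : 1 <= p ->
  filterlim (fun t => Rpower t p * exp (- t)) (at_right 0) (locally 0).
Proof.
  intros Hp. apply (filterlim_squeeze_0 _ _ (fun t => t)).
  - generalize (at_right_0_le 1 Rlt_0_1). apply filter_imp.
    intros t Ht. split; [left; apply gamma_integrand_pos |].
    rewrite <- (Rpower_1 t) at 3 by easy.
    unfold Rpower. rewrite <- exp_plus. apply exp_le_mono.
    assert (ln t <= 0) by (pose proof (ln_le_sub1 t); lra). nra.
  - intros P [eps HP]. exists eps. intros y Hy _. now apply HP.
Qed.

Lemma filterlim_Rpower_exp_p_infty (p : R) : 0 <= p ->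
  filterlim (fun t => Rpower t p * exp (- t)) (Rbar_locally p_infty) (locally 0).
Proof.
  (* The additional power of [t] is spent on the factor [/ t] of the dominating function. *)
  intros Hp. destruct (Rpower_exp_decay (p + 1)) as (C & HC & HCb); [lra |].
  apply (filterlim_squeeze_0 _ _ (fun t => C * / t)).
  - exists 0. intros t Ht. split; [left; apply gamma_integrand_pos |].
    specialize (HCb t Ht). rewrite Rpower_plus, Rpower_1 in HCb by easy.
    apply Rmult_le_reg_r with t; [easy |].
    rewrite (Rmult_assoc C), Rinv_l, Rmult_1_r by lra.
    assert (exp (- t / 2) <= 1) by (rewrite <- exp_0; apply exp_le_mono; lra).
    apply Rle_trans with (C * exp (- t / 2)); nra.
  - replace 0 with (C * 0) by ring.
    apply (is_lim_scal_l (fun t => / t) C p_infty 0).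
    apply (is_lim_inv (fun t => t) p_infty p_infty); [apply is_lim_id | easy].
Qed.

Lemma filter_prod_pos_interval (P : R -> Prop) :
  (forall x, 0 < x -> P x) ->
  filter_prod (at_right 0) (Rbar_locally p_infty)
    (fun ab : R * R => forall x, Rmin (fst ab) (snd ab) <= x <= Rmax (fst ab) (snd ab) -> P x).
Proof.
  intros HP.
  apply (Filter_prod _ _ _ (fun t => 0 < t <= 1) (fun t => 1 < t)).
  - apply at_right_0_le; lra.
  - now exists 1.
  - intros a b Ha Hb x Hx. simpl in Hx. apply HP.
    rewrite Rmin_left in Hx; lra.
Qed.

Lemma is_RInt_gen_derive_pos (F dF : R -> R) (la lb : R) :
  (forall t, 0 < t -> is_derive F t (dF t)) ->
  (forall t, 0 < t -> continuous dF t) ->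
  filterlim F (at_right 0) (locally la) ->
  filterlim F (Rbar_locally p_infty) (locally lb) ->
  is_RInt_gen dF (at_right 0) (Rbar_locally p_infty) (lb - la).
Proof.
  intros HF HdF Ha Hb.
  apply (is_RInt_gen_ext (Derive F)).
  - generalize (filter_prod_pos_interval (fun x => Derive F x = dF x)
      (fun x Hx => is_derive_unique _ _ _ (HF x Hx))).
    apply filter_imp. intros ab H x Hx. apply H. lra.
  - apply is_RInt_gen_Derive; try easy.
    + apply filter_prod_pos_interval. intros x Hx. eexists. now apply HF.
    + apply filter_prod_pos_interval. intros x Hx.
      apply (continuous_ext_loc _ dF); [| now apply HdF].
      exists (mkposreal x Hx). intros y Hy. symmetry. apply is_derive_unique, HF.
      change (Rabs (y + - x) < x) in Hy. apply Rabs_def2 in Hy. lra.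
Qed.

(** Integration by parts: the derivative of [t ^ x * exp (- t)] integrates to zero because both
    boundary values vanish, and subtracting it from [x] times the integrand of [Gamma x] leaves that
    of [Gamma (x + 1)]. *)
Lemma Gamma_plus_1 (x : R) : 1 <= x -> Gamma (x + 1) = x * Gamma x.
Proof.
  intros Hx.
  assert (H1 : is_RInt_gen (fun t => x * (Rpower t (x - 1) * exp (- t)) - Rpower t x * exp (- t))
    (at_right 0) (Rbar_locally p_infty) (0 - 0)).
  { apply (is_RInt_gen_derive_pos (fun t => Rpower t x * exp (- t))).
    - intros t Ht.
      apply (is_derive_ext (fun t => mult (Rpower t x) (exp (- t)))); [easy |].
      evar_last.
      + apply @is_derive_mult; [now apply is_derive_Rpower | | apply Rmult_comm].
        auto_derive; [easy | reflexivity].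
      + unfold plus, mult; simpl. ring.
    - intros t Ht. apply @continuous_minus.
      + apply @continuous_mult; [apply continuous_const |].
        now apply continuous_gamma_integrand.
      + now apply continuous_gamma_integrand.
    - apply filterlim_Rpower_exp_0; lra.
    - apply filterlim_Rpower_exp_p_infty; lra. }
  pose proof (is_RInt_gen_minus _ _ _ _
    (is_RInt_gen_scal _ x _ (is_RInt_gen_Gamma x Hx)) H1) as H2.
  unfold Gamma at 1. apply is_RInt_gen_unique.
  replace (x * Gamma x) with (minus (scal x (Gamma x)) (0 - 0))
    by (unfold minus, plus, opp, scal; simpl; unfold mult; simpl; ring).
  eapply is_RInt_gen_ext; [| exact H2].
  apply filter_forall. intros ab t _.
  replace (x + 1 - 1) with x by ring.
  unfold minus, plus, opp, scal; simpl; unfold mult; simpl; ring.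
Qed.

Lemma Gamma_1 : Gamma 1 = 1.
Proof.
  assert (H : is_RInt_gen (fun t => Rpower t (1 - 1) * exp (- t))
    (at_right 0) (Rbar_locally p_infty) (0 - (- 1))).
  { apply (is_RInt_gen_derive_pos (fun t => - exp (- t))).
  - intros t Ht. replace (1 - 1) with 0 by ring. rewrite Rpower_O by easy.
    auto_derive; [easy | ring].
  - intros t Ht. now apply continuous_gamma_integrand.
  - replace (- 1) with (- exp (- 0)) by (rewrite Ropp_0, exp_0; ring).
    apply (filterlim_filter_le_1 (F := locally 0) (G := at_right 0)).
    + intros P [eps HP]. exists eps. intros y Hy _. now apply HP.
    + apply (@ex_derive_continuous R_AbsRing R_NormedModule (fun t => - exp (- t)) 0).
      auto_derive. easy.
  - replace 0 with (- 0) by ring.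
    apply (filterlim_comp _ _ _ (fun t => exp (- t)) Ropp _ (locally 0)).
    + apply (filterlim_ext_loc (fun t => Rpower t 0 * exp (- t))).
      * exists 0. intros t Ht. rewrite Rpower_O by easy. ring.
      * apply filterlim_Rpower_exp_p_infty. lra.
    + apply (filterlim_opp (0 : R_NormedModule)). }
  unfold Gamma. rewrite (is_RInt_gen_unique _ _ H). ring.
Qed.

(** Tangent bounds at [c * u] for [exp u] and [exp 0], averaged with weights [c] and [1 - c]; the
    terms linear in [u] cancel. *)
Lemma exp_weighted_le (c u : R) : 0 <= c <= 1 ->
  exp (c * u) <= (1 - c) + c * exp u.
Proof.
  intros Hc.
  assert (H1 : exp (c * u) * (1 + (1 - c) * u) <= exp u).
  { replace (exp u) with (exp (c * u) * exp ((1 - c) * u))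
      by (rewrite <- exp_plus; f_equal; ring).
    apply Rmult_le_compat_l; [left; apply exp_pos | apply exp_ineq1_le]. }
  assert (H2 : exp (c * u) * (1 - c * u) <= 1).
  { replace 1 with (exp (c * u) * exp (- (c * u))) at 2
      by (rewrite <- exp_plus, <- exp_0; f_equal; ring).
    apply Rmult_le_compat_l; [left; apply exp_pos |].
    pose proof (exp_ineq1_le (- (c * u))). lra. }
  nra.
Qed.

(* Integrate the tangent line of the concave function [t ^ c] at [t = x]. *)
Lemma Gamma_add_le (x c : R) : 1 <= x -> 0 <= c <= 1 ->
  Gamma (x + c) <= Rpower x c * Gamma x.
Proof.
  intros Hx Hc.
  assert (Hx1 : 1 <= x + 1) by lra. assert (Hxc : 1 <= x + c) by lra.
  pose proof (is_RInt_gen_scal _ ((1 - c) * Rpower x c) _ (is_RInt_gen_Gamma x Hx)) as H1.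
  pose proof (is_RInt_gen_scal _ (c * Rpower x c / x) _
    (is_RInt_gen_Gamma (x + 1) Hx1)) as H2.
  pose proof (is_RInt_gen_plus _ _ _ _ H1 H2) as H3. clear H1 H2.
  pose proof (is_RInt_gen_Gamma (x + c) Hxc) as H4.
  rewrite Gamma_plus_1 in H3 by easy.
  replace (Rpower x c * Gamma x) with
    (plus (scal ((1 - c) * Rpower x c) (Gamma x)) (scal (c * Rpower x c / x) (x * Gamma x)))
    by (unfold plus, scal; simpl; unfold mult; simpl; field; lra).
  rewrite <- (Rabs_pos_eq (Gamma (x + c))) by (left; apply Gamma_pos; lra).
  eapply (RInt_gen_norm (V := R_CompleteNormedModule)
    (Fa := at_right 0) (Fb := Rbar_locally p_infty)); [| | exact H4 | exact H3].
  - apply (Filter_prod _ _ _ (fun t => 0 < t <= 1) (fun t => 1 < t)).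
    + apply at_right_0_le; lra.
    + now exists 1.
    + simpl. intros; lra.
  - apply (Filter_prod _ _ _ (fun t => 0 < t <= 1) (fun t => 1 < t)).
    + apply at_right_0_le; lra.
    + now exists 1.
    + simpl. intros a b Ha Hb t Ht.
      unfold norm; simpl. unfold abs; simpl.
      rewrite Rabs_pos_eq by (left; apply gamma_integrand_pos).
      unfold plus, scal; simpl; unfold mult; simpl.
      replace (x + 1 - 1) with ((x - 1) + 1) by ring.
      replace (x + c - 1) with ((x - 1) + c) by ring.
      rewrite !Rpower_plus, Rpower_1 by lra.
      (* The tangent line at [t = x], obtained from [exp_weighted_le] with [u = ln (t / x)]. *)
      assert (Hkey : Rpower t c <= Rpower x c * ((1 - c) + c * (t / x))).
      { replace (t / x) with (exp (ln (t / x))).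
        2:{ apply exp_ln. apply Rdiv_lt_0_compat; lra. }
        replace (Rpower t c) with (Rpower x c * exp (c * ln (t / x))).
        - apply Rmult_le_compat_l; [left; apply Rpower_pos | now apply exp_weighted_le].
        - unfold Rpower. rewrite <- exp_plus, ln_div by lra. f_equal. ring. }
      pose proof (gamma_integrand_pos (x - 1) t) as Hp.
      apply Rle_trans with ((Rpower t (x - 1) * exp (- t)) * Rpower t c); [right; ring |].
      apply Rle_trans with ((Rpower t (x - 1) * exp (- t)) * (Rpower x c * ((1 - c) + c * (t / x)))).
      * apply Rmult_le_compat_l; lra.
      * right. field. lra.
Qed.

(** * Binomial coefficients of [(1 - z) ^ (- c)] *)

(* [rbin n c] is the coefficient of [z ^ n] in [(1 - z) ^ (- c)]. *)
Fixpoint rbin (n : nat) (c : R) : R :=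
  match n with
  | O => 1
  | S m => rbin m c * (c + INR m) / INR (S m)
  end.

Lemma INR_S_neq_0 (n : nat) : INR (S n) <> 0.
Proof. apply not_0_INR. easy. Qed.

Lemma rbin_S_mul (n : nat) (c : R) : INR (S n) * rbin (S n) c = rbin n c * (c + INR n).
Proof. cbn [rbin]. field. apply INR_S_neq_0. Qed.

(** Coefficient form of [(1 - z) ^ (- c) * (1 - z) ^ (- d) = (1 - z) ^ (- (c + d))]. The induction
    multiplies by [n + 1 = (n + 1 - j) + j], which is the Leibniz rule for [z d/dz]. *)
Lemma rbin_vandermonde (n : nat) (c d : R) :
  sum_f_R0 (fun j => rbin (n - j) d * rbin j c) n = rbin n (c + d).
Proof.
  induction n as [| n IH]; [simpl; ring |].
  apply Rmult_eq_reg_l with (INR (S n)); [| apply INR_S_neq_0].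
  rewrite rbin_S_mul, <- IH.
  assert (H : INR (S n) * sum_f_R0 (fun j => rbin (S n - j) d * rbin j c) (S n) =
    sum_f_R0 (fun j => INR (S n - j) * rbin (S n - j) d * rbin j c) (S n) +
    sum_f_R0 (fun j => rbin (S n - j) d * (INR j * rbin j c)) (S n)).
  { rewrite <- plus_sum, scal_sum. apply sum_eq. intros i Hi.
    rewrite minus_INR by easy. ring. }
  (* The first sum loses its last term and the second its first term, both being zero; after
     reindexing, the factors add up to [c + d + n]. *)
  rewrite H, tech5, (decomp_sum (fun j => rbin (S n - j) d * (INR j * rbin j c))) by lia.
  replace (S n - S n)%nat with O by lia. simpl (INR 0). simpl (Init.Nat.pred (S n)).
  rewrite !Rmult_0_l, Rmult_0_r, Rplus_0_r, Rplus_0_l, <- plus_sum.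
  rewrite Rmult_comm, scal_sum. apply sum_eq. intros i Hi.
  replace (S n - i)%nat with (S (n - i)) by lia.
  replace (S n - S i)%nat with (n - i)%nat by lia.
  rewrite !rbin_S_mul, minus_INR by easy. ring.
Qed.

Lemma rbin_1 (n : nat) : rbin n 1 = 1.
Proof.
  induction n as [| n IH]; [easy |]. cbn [rbin]. rewrite IH, S_INR. field.
  pose proof (pos_INR n). lra.
Qed.

Lemma rbin_0 (n : nat) : rbin (S n) 0 = 0.
Proof.
  induction n as [| n IH]; [simpl; field |]. cbn [rbin] in *. rewrite IH. unfold Rdiv. ring.
Qed.

Lemma rbin_pos (n : nat) (c : R) : 0 < c -> 0 < rbin n c.
Proof.
  intros Hc. induction n as [| n IH]; [simpl; lra |]. cbn [rbin].
  apply Rdiv_lt_0_compat; [| apply lt_0_INR; lia].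
  pose proof (pos_INR n). apply Rmult_lt_0_compat; lra.
Qed.

(** The coefficient of [z] is [- c], and each later factor [- c + n] with [n >= 1] is nonnegative.
    This is the sign of the coefficients of [1 - (1 - z) ^ c]. *)
Lemma rbin_opp_nonpos (n : nat) (c : R) : 0 <= c <= 1 -> rbin (S n) (- c) <= 0.
Proof.
  intros Hc. induction n as [| n IH]; [simpl; lra |].
  apply Rmult_le_reg_l with (INR (S (S n))); [apply lt_0_INR; lia |].
  rewrite rbin_S_mul, Rmult_0_r, S_INR. pose proof (pos_INR n). nra.
Qed.

Lemma rbin_decr (c : R) (m n : nat) : 0 < c <= 1 -> (m <= n)%nat -> rbin n c <= rbin m c.
Proof.
  intros Hc Hmn. induction Hmn as [| n Hmn IH]; [lra |].
  apply Rle_trans with (rbin n c); [| easy].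
  apply Rmult_le_reg_l with (INR (S n)); [apply lt_0_INR; lia |].
  rewrite rbin_S_mul, S_INR, Rmult_comm.
  apply Rmult_le_compat_r; [| lra]. left. now apply rbin_pos.
Qed.

Lemma rbin_param_succ (n : nat) (c : R) : rbin n (c + 1) * c = rbin n c * (c + INR n).
Proof.
  induction n as [| n IH]; [simpl; ring |].
  apply Rmult_eq_reg_l with (INR (S n)); [| apply INR_S_neq_0].
  rewrite <- !Rmult_assoc, !rbin_S_mul, S_INR.
  transitivity ((rbin n (c + 1) * c) * (c + 1 + INR n)); [ring | rewrite IH; ring].
Qed.

(** Links the coefficients to [Gamma], so that bounds on Gamma ratios become asymptotics of
    [rbin]. *)
Lemma rbin_Gamma (n : nat) (c : R) : 1 <= c ->
  rbin n c * Gamma c * INR (fact n) = Gamma (INR n + c).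
Proof.
  intros Hc. induction n as [| n IH]; [simpl; rewrite Rplus_0_l; ring |].
  rewrite S_INR. replace (INR n + 1 + c) with (INR n + c + 1) by ring.
  pose proof (pos_INR n). rewrite Gamma_plus_1 by lra. rewrite <- IH.
  rewrite fact_simpl, mult_INR.
  transitivity (INR (S n) * rbin (S n) c * Gamma c * INR (fact n)); [ring |].
  rewrite rbin_S_mul. ring.
Qed.

Lemma Gamma_fact (n : nat) : Gamma (INR n + 1) = INR (fact n).
Proof. rewrite <- rbin_Gamma, rbin_1, Gamma_1 by lra. ring. Qed.

(** Carries estimates known for exponents in [[0, 1]] to all nonnegative exponents by unit steps,
    matching the functional equation of [Gamma]. *)
Lemma nonneg_unit_ind (P : R -> Prop) :
  (forall y, 0 <= y <= 1 -> P y) -> (forall y, 0 <= y -> P y -> P (y + 1)) ->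
  forall y, 0 <= y -> P y.
Proof.
  intros H0 HS.
  assert (H : forall n y, 0 <= y <= INR n + 1 -> P y).
  { induction n as [| n IH]; intros y Hy; [apply H0; simpl in Hy; lra |].
    destruct (Rle_dec y 1) as [Hy1 | Hy1]; [apply H0; lra |].
    replace y with (y - 1 + 1) by ring. rewrite S_INR in Hy.
    apply HS; [lra |]. apply IH. lra. }
  intros y Hy. destruct (INR_unbounded y) as [n Hn]. apply (H n). lra.
Qed.

Lemma Gamma_add_le_pow (x y : R) : 1 <= x -> 0 <= y ->
  Gamma (x + y) <= Rpower (x + y) y * Gamma x.
Proof.
  intros Hx. pose proof (Gamma_pos x Hx) as Hg.
  apply (nonneg_unit_ind (fun y => Gamma (x + y) <= Rpower (x + y) y * Gamma x)).
  - intros z Hz. eapply Rle_trans; [now apply Gamma_add_le |].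
    apply Rmult_le_compat_r; [lra |]. apply Rle_Rpower_l; lra.
  - intros z Hz IH. rewrite <- Rplus_assoc, Gamma_plus_1 by lra.
    rewrite Rpower_plus, Rpower_1 by lra.
    pose proof (Gamma_pos (x + z) ltac:(lra)).
    apply Rle_trans with ((x + z + 1) * (Rpower (x + z + 1) z * Gamma x)); [| right; ring].
    apply Rmult_le_compat; [lra | lra | lra |].
    eapply Rle_trans; [exact IH |]. apply Rmult_le_compat_r; [lra |].
    apply Rle_Rpower_l; lra.
Qed.

(** A bound at every [n >= 1], not only asymptotic: it supplies the domination for the passage to
    the limit. *)
Lemma rbin_scaled_le (n : nat) (y : R) : (0 < n)%nat -> 0 <= y ->
  rbin n (y + 1) * Rpower (INR n) (- y)
    <= Rpower ((INR n + 1 + y) / INR n) y / Gamma (y + 1).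
Proof.
  intros Hn Hy. assert (Hn' : 0 < INR n) by now apply lt_0_INR.
  pose proof (Gamma_pos (y + 1) ltac:(lra)) as Hg.
  assert (Hf : 0 < INR (fact n)) by apply INR_fact_lt_0.
  assert (H : rbin n (y + 1) * Gamma (y + 1) <= Rpower (INR n + 1 + y) y).
  { apply Rmult_le_reg_r with (INR (fact n)); [easy |].
    rewrite rbin_Gamma by lra. rewrite <- Gamma_fact.
    replace (INR n + (y + 1)) with (INR n + 1 + y) by ring.
    apply Gamma_add_le_pow; lra. }
  apply Rmult_le_reg_r with (Gamma (y + 1)); [easy |].
  unfold Rdiv at 1. rewrite (Rmult_assoc _ (/ _)), Rinv_l, Rmult_1_r by lra.
  replace (Rpower ((INR n + 1 + y) / INR n) y)
    with (Rpower (INR n + 1 + y) y * Rpower (INR n) (- y)).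
  - pose proof (Rpower_pos (INR n) (- y)). nra.
  - unfold Rpower. rewrite ln_div, <- exp_plus by lra. f_equal. ring.
Qed.

Lemma is_lim_seq_INR_ratio (a b : R) : is_lim_seq (fun n => (INR n + a) / (INR n + b)) 1.
Proof.
  apply is_lim_seq_ext_loc with (fun n => 1 + (a - b) * / (INR n + b)).
  - destruct (INR_unbounded (- b)) as [N HN]. exists N. intros n Hn.
    apply le_INR in Hn. field. lra.
  - replace (Finite 1) with (Finite (1 + (a - b) * 0)) by (f_equal; ring).
    apply is_lim_seq_plus'; [apply is_lim_seq_const |].
    apply (is_lim_seq_scal_l _ (a - b) 0).
    apply (is_lim_seq_inv _ p_infty); [| easy].
    apply (is_lim_seq_plus _ _ p_infty b p_infty);
      [apply is_lim_seq_INR | apply is_lim_seq_const | easy].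
Qed.

(** For [y] in [[0, 1]] the ratio [Gamma (n + 1 + y) / n!] is squeezed by [Gamma_add_le], from above
    with increment [y] and from below with increment [1 - y]. Larger [y] follow from
    [rbin_param_succ]. *)
Lemma rbin_scaled_limit (y : R) : 0 <= y ->
  is_lim_seq (fun n => rbin n (y + 1) * Rpower (INR n) (- y)) (/ Gamma (y + 1)).
Proof.
  apply (nonneg_unit_ind (fun y =>
    is_lim_seq (fun n => rbin n (y + 1) * Rpower (INR n) (- y)) (/ Gamma (y + 1)))).
  - clear y. intros y Hy.
    pose proof (Gamma_pos (y + 1) ltac:(lra)) as Hg.
    apply (is_lim_seq_le_le_loc
      (fun n => / Gamma (y + 1) * ((INR n + 1) / (INR n + 2))) _
      (fun n => / Gamma (y + 1) * ((INR n + 1) / (INR n + 0)))).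
    + exists 1%nat. intros n Hn. assert (Hn' : 0 < INR n) by (apply lt_0_INR; lia).
      assert (Hf : 0 < INR (fact n)) by apply INR_fact_lt_0.
      assert (Hr : rbin n (y + 1) = / Gamma (y + 1) * (Gamma (INR n + 1 + y) / INR (fact n))).
      { replace (INR n + 1 + y) with (INR n + (y + 1)) by ring.
        rewrite <- rbin_Gamma by lra. field. lra. }
      rewrite Hr, Rmult_assoc. rewrite Rplus_0_r.
      split; (apply Rmult_le_compat_l; [left; now apply Rinv_0_lt_compat |]).
      (* The increment [1 - y] leads from [n + 1 + y] to the integer [n + 2], where [Gamma] is a
         factorial. *)
      * pose proof (Gamma_add_le (INR n + 1 + y) (1 - y) ltac:(lra) ltac:(lra)) as H.
        replace (INR n + 1 + y + (1 - y)) with (INR n + 1 + 1) in H by ring.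
        rewrite Gamma_plus_1, Gamma_fact in H by lra.
        assert (H' : Rpower (INR n + 1 + y) (1 - y) <= (INR n + 2) * Rpower (INR n) (- y)).
        { apply Rle_trans with (Rpower (INR n + 2) (1 - y)); [apply Rle_Rpower_l; lra |].
          unfold Rminus. rewrite Rpower_plus, Rpower_1 by lra.
          apply Rmult_le_compat_l; [lra |]. rewrite !Rpower_Ropp.
          apply Rinv_le_contravar; [apply Rpower_pos | apply Rle_Rpower_l; lra]. }
        pose proof (Gamma_pos (INR n + 1 + y) ltac:(lra)) as Hg'.
        apply Rmult_le_reg_r with ((INR n + 2) * INR (fact n)); [nra |].
        apply Rle_trans with ((INR n + 1) * INR (fact n)); [right; field; lra |].
        apply Rle_trans with (Gamma (INR n + 1 + y) * ((INR n + 2) * Rpower (INR n) (- y)));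
          [| right; field; lra]. nra.
      * pose proof (Gamma_add_le (INR n + 1) y ltac:(lra) Hy) as H.
        rewrite Gamma_fact in H.
        apply Rle_trans with (Rpower ((INR n + 1) / INR n) y).
        -- replace (Rpower ((INR n + 1) / INR n) y)
             with (Rpower (INR n + 1) y * Rpower (INR n) (- y)).
           ++ apply Rmult_le_compat_r; [left; apply Rpower_pos |].
              apply Rmult_le_reg_r with (INR (fact n)); [easy |].
              unfold Rdiv. rewrite Rmult_assoc, Rinv_l by lra. lra.
           ++ unfold Rpower. rewrite ln_div, <- exp_plus by lra. f_equal. ring.
        -- assert (H1 : 1 <= (INR n + 1) / INR n).
           { apply Rmult_le_reg_r with (INR n); [easy |]. field_simplify; lra. }
           rewrite <- (Rpower_1 ((INR n + 1) / INR n)) at 2 by lra.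
           apply Rle_Rpower; lra.
    + replace (Finite (/ Gamma (y + 1))) with (Rbar_mult (/ Gamma (y + 1)) 1)
        by (simpl; f_equal; ring).
      apply is_lim_seq_scal_l, is_lim_seq_INR_ratio.
    + replace (Finite (/ Gamma (y + 1))) with (Rbar_mult (/ Gamma (y + 1)) 1)
        by (simpl; f_equal; ring).
      apply is_lim_seq_scal_l, is_lim_seq_INR_ratio.
  - clear y. intros y Hy IH.
    pose proof (Gamma_pos (y + 1) ltac:(lra)) as Hg.
    apply is_lim_seq_ext_loc with
      (fun n => (rbin n (y + 1) * Rpower (INR n) (- y)) *
                (/ (y + 1) * ((INR n + (y + 1)) / (INR n + 0)))).
    + exists 1%nat. intros n Hn. assert (Hn' : 0 < INR n) by (apply lt_0_INR; lia).
      apply Rmult_eq_reg_r with (y + 1); [| lra].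
      transitivity ((rbin n (y + 1 + 1) * (y + 1)) * Rpower (INR n) (- (y + 1))); [| ring].
      rewrite rbin_param_succ, Ropp_plus_distr, Rpower_plus, (Rpower_Ropp _ 1), Rpower_1
        by easy.
      field. lra.
    + rewrite (Gamma_plus_1 (y + 1)) by lra.
      replace (/ ((y + 1) * Gamma (y + 1))) with (/ Gamma (y + 1) * (/ (y + 1) * 1))
        by (field; lra).
      apply is_lim_seq_mult'; [exact IH |].
      apply (is_lim_seq_scal_l _ (/ (y + 1)) 1), is_lim_seq_INR_ratio.
Qed.

(** The parameter [1 - c] is below 1, so it is first raised to [2 - c]; the limit is
    [1 / Gamma (1 - c)] written with an argument at least 1. *)
Lemma rbin_1_opp_scaled_limit (c : R) : 0 < c < 1 ->
  is_lim_seq (fun n => rbin n (1 - c) * Rpower (INR n) c) ((1 - c) / Gamma (2 - c)).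
Proof.
  intros Hc. pose proof (rbin_scaled_limit (1 - c) ltac:(lra)) as H.
  replace (1 - c + 1) with (2 - c) in H by ring.
  apply is_lim_seq_ext_loc with
    (fun n => (rbin n (2 - c) * Rpower (INR n) (- (1 - c))) *
              ((1 - c) * ((INR n + 0) / (INR n + (1 - c))))).
  - exists 1%nat. intros n Hn. assert (Hn' : 0 < INR n) by (apply lt_0_INR; lia).
    replace (Rpower (INR n) c) with (Rpower (INR n) (- (1 - c)) * INR n).
    2:{ rewrite <- (Rpower_1 (INR n)) at 2 by easy. rewrite <- Rpower_plus. f_equal. ring. }
    apply Rmult_eq_reg_r with (INR n + (1 - c)); [| lra].
    transitivity ((rbin n (1 - c + 1) * (1 - c)) * (Rpower (INR n) (- (1 - c)) * INR n)).
    + replace (1 - c + 1) with (2 - c) by ring. field. lra.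
    + rewrite rbin_param_succ. ring.
  - replace ((1 - c) / Gamma (2 - c)) with (/ Gamma (2 - c) * ((1 - c) * 1))
      by (unfold Rdiv; ring).
    apply is_lim_seq_mult'; [exact H |].
    apply (is_lim_seq_scal_l _ (1 - c) 1), is_lim_seq_INR_ratio.
Qed.

(** * The discrete Mittag-Leffler function *)

(** Bernoulli's inequality for [(/ q) ^ k]. *)
Lemma pow_mul_INR_bounded (q : R) : 0 < q < 1 ->
  forall k, INR k * q ^ k <= / (/ q - 1).
Proof.
  intros Hq k.
  assert (Hi : 1 < / q) by (rewrite <- Rinv_1; apply Rinv_lt_contravar; lra).
  pose proof (poly k (/ q - 1) ltac:(lra)) as H.
  replace (1 + (/ q - 1)) with (/ q) in H by ring.
  rewrite pow_inv in H. pose proof (pow_lt q k ltac:(lra)) as Hk.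
  apply Rmult_le_reg_r with (/ q - 1); [lra |]. rewrite Rinv_l by lra.
  apply Rle_trans with (q ^ k * (1 + INR k * (/ q - 1))); [nra |].
  apply Rle_trans with (q ^ k * / q ^ k); [nra |]. right. field. lra.
Qed.

(** [rbin n] is a polynomial in its parameter, hence is beaten by any geometric decay. Each
    induction step splits [q = r * r]: one [r] for the induction hypothesis, one for the new linear
    factor. *)
Lemma rbin_affine_subexp (a c : R) (n : nat) : forall q, 0 < q < 1 ->
  exists C, forall k, Rabs (rbin n (INR k * a + c)) * q ^ k <= C.
Proof.
  induction n as [| n IH]; intros q Hq.
  - exists 1. intros k. simpl. rewrite Rabs_R1, Rmult_1_l.
    rewrite <- (pow1 k). apply pow_incr. lra.
  - set (r := sqrt q).
    assert (Hr : 0 < r < 1).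
    { split; [apply sqrt_lt_R0; lra |]. rewrite <- sqrt_1. apply sqrt_lt_1; lra. }
    assert (Hrr : q = r * r) by (symmetry; apply sqrt_sqrt; lra).
    destruct (IH r Hr) as [C HC].
    exists (C * (Rabs a * / (/ r - 1) + Rabs (c + INR n))).
    intros k. cbn [rbin].
    pose proof (pow_lt r k ltac:(lra)) as Hrk.
    assert (Hrk1 : r ^ k <= 1) by (rewrite <- (pow1 k); apply pow_incr; lra).
    assert (Hlin : Rabs (INR k * a + c + INR n) * r ^ k
              <= Rabs a * / (/ r - 1) + Rabs (c + INR n)).
    { apply Rle_trans with ((INR k * Rabs a + Rabs (c + INR n)) * r ^ k).
      - apply Rmult_le_compat_r; [lra |].
        replace (INR k * a + c + INR n) with (INR k * a + (c + INR n)) by ring.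
        eapply Rle_trans; [apply Rabs_triang |].
        rewrite Rabs_mult, (Rabs_pos_eq (INR k)) by apply pos_INR. lra.
      - pose proof (pow_mul_INR_bounded r Hr k). pose proof (Rabs_pos a).
        pose proof (Rabs_pos (c + INR n)). nra. }
    assert (Hn : 1 <= INR (S n)) by (rewrite S_INR; pose proof (pos_INR n); lra).
    unfold Rdiv. rewrite !Rabs_mult, Rabs_inv, (Rabs_pos_eq (INR (S n))) by lra.
    rewrite Hrr, Rpow_mult_distr.
    apply Rle_trans with ((Rabs (rbin n (INR k * a + c)) * r ^ k) *
      (Rabs (INR k * a + c + INR n) * r ^ k)).
    + assert (/ INR (S n) <= 1) by (rewrite <- Rinv_1; apply Rinv_le_contravar; lra).
      set (A := Rabs (rbin n (INR k * a + c)) * r ^ k *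
        (Rabs (INR k * a + c + INR n) * r ^ k)).
      assert (0 <= A).
      { unfold A. repeat apply Rmult_le_pos; try apply Rabs_pos; lra. }
      replace (_ * _ * _ * _) with (A * / INR (S n)) by (unfold A; ring). nra.
    + apply Rmult_le_compat; try easy; apply Rmult_le_pos; try apply Rabs_pos; lra.
Qed.

(* With [alpha = a] and [mu = x * h ^ a], [dml a mu 1 n] is the value at time [n * h]
   of the convolution-quadrature approximation of [ML a 1 (- x * t ^ a)];
   it is the coefficient of [z ^ n] in [(1 - z) ^ (a - c) / (mu + (1 - z) ^ a)]. *)
Definition dml (a mu c : R) (n : nat) : R :=
  Series (fun k => (- mu) ^ k * rbin n (INR k * a + c)).

Lemma ex_series_dml (a mu c : R) (n : nat) : 0 <= mu < 1 ->
  ex_series (fun k => (- mu) ^ k * rbin n (INR k * a + c)).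
Proof.
  (* Any [q] strictly between [mu] and 1 works: the ratio [mu / q] of the majorant is then below
     1. *)
  intros Hmu. set (q := (1 + mu) / 2).
  assert (Hq : 0 < q < 1) by (unfold q; lra).
  destruct (rbin_affine_subexp a c n q Hq) as [C HC].
  apply (@ex_series_le R_AbsRing R_CompleteNormedModule _ (fun k => (mu / q) ^ k * C)).
  - intros k. change (Rabs ((- mu) ^ k * rbin n (INR k * a + c)) <= (mu / q) ^ k * C).
    rewrite Rabs_mult, <- RPow_abs, Rabs_Ropp, (Rabs_pos_eq mu) by easy.
    pose proof (pow_lt q k ltac:(lra)) as Hqk.
    apply Rle_trans with ((mu / q) ^ k * (Rabs (rbin n (INR k * a + c)) * q ^ k)).
    + unfold Rdiv. rewrite Rpow_mult_distr, pow_inv. right. field. lra.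
    + apply Rmult_le_compat_l; [| easy]. apply pow_le.
      apply Rdiv_le_0_compat; lra.
  - apply ex_series_scal_r, ex_series_geom. rewrite Rabs_pos_eq.
    + apply Rmult_lt_reg_r with q; [lra |]. unfold Rdiv.
      rewrite Rmult_assoc, Rinv_l by lra. unfold q. lra.
    + apply Rdiv_le_0_compat; lra.
Qed.

Lemma is_series_sum_f_R0 (F : nat -> nat -> R) (l : nat -> R) (n : nat) :
  (forall j, is_series (F j) (l j)) ->
  is_series (fun k => sum_f_R0 (fun j => F j k) n) (sum_f_R0 l n).
Proof.
  intros HF. induction n as [| n IH]; [apply HF |].
  exact (is_series_plus _ _ _ _ IH (HF (S n))).
Qed.

(** Multiplication of the generating function by [(1 - z) ^ (- d)]; in the series this is
    [rbin_vandermonde] term by term. *)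
Lemma dml_conv (a mu c d : R) (n : nat) : 0 <= mu < 1 ->
  sum_f_R0 (fun j => rbin (n - j) d * dml a mu c j) n = dml a mu (c + d) n.
Proof.
  intros Hmu. symmetry. apply is_series_unique.
  eapply is_series_ext; [| apply (is_series_sum_f_R0
    (fun j k => rbin (n - j) d * ((- mu) ^ k * rbin j (INR k * a + c))))].
  - intros k. simpl. rewrite <- Rplus_assoc, <- rbin_vandermonde, scal_sum.
    apply sum_eq. intros; ring.
  - intros j. apply (is_series_scal (V := R_NormedModule) (rbin (n - j) d) _ (dml a mu c j)).
    apply Series_correct, ex_series_dml, Hmu.
Qed.

(** Splits off the term [k = 0]. With [w = (1 - z) ^ a] it reads [w / (mu + w) = 1 - mu / (mu + w)],
    multiplied by [(1 - z) ^ (- c)]. *)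
Lemma dml_shift (a mu c : R) (n : nat) : 0 <= mu < 1 ->
  dml a mu c n = rbin n c - mu * dml a mu (c + a) n.
Proof.
  intros Hmu. unfold dml. rewrite Series_incr_1 by now apply ex_series_dml.
  simpl (INR 0). rewrite Rmult_0_l, Rplus_0_l, pow_O, Rmult_1_l.
  rewrite <- Series_scal_l. unfold Rminus. rewrite <- Series_opp. f_equal.
  apply Series_ext. intros k. rewrite S_INR.
  replace ((INR k + 1) * a + c) with (INR k * a + (c + a)) by ring. simpl. ring.
Qed.

Lemma dml_alpha_0 (a mu : R) : 0 <= mu < 1 -> dml a mu a 0 = / (1 + mu).
Proof.
  intros Hmu. unfold dml. simpl.
  rewrite (Series_ext _ (fun k => (- mu) ^ k)) by (intros; ring).
  rewrite Series_geom by (rewrite Rabs_Ropp, Rabs_pos_eq; lra).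
  f_equal. ring.
Qed.

(** For [c = a] the generating function is [1 / (mu + (1 - z) ^ a)]. Comparing coefficients in its
    product with the denominator and isolating the newest one gives this renewal equation, whose
    weights are nonnegative for [0 <= a <= 1]. *)
Lemma dml_alpha_S (a mu : R) (n : nat) : 0 <= mu < 1 ->
  dml a mu a (S n) =
  / (1 + mu) * sum_f_R0 (fun j => - rbin (S n - j) (- a) * dml a mu a j) n.
Proof.
  intros Hmu. pose proof (dml_conv a mu a (- a) (S n) Hmu) as H.
  rewrite tech5, Rplus_opp_r, (dml_shift a mu 0), rbin_0, Rplus_0_l in H by easy.
  replace (S n - S n)%nat with O in H by lia. cbn [rbin] in H.
  replace (sum_f_R0 (fun j => - rbin (S n - j) (- a) * dml a mu a j) n)
    with (- sum_f_R0 (fun j => rbin (S n - j) (- a) * dml a mu a j) n).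
  - apply Rmult_eq_reg_l with (1 + mu); [| lra].
    rewrite <- Rmult_assoc, Rinv_r by lra. lra.
  - replace (- sum_f_R0 (fun j => rbin (S n - j) (- a) * dml a mu a j) n)
      with (- 1 * sum_f_R0 (fun j => rbin (S n - j) (- a) * dml a mu a j) n) by ring.
    rewrite scal_sum. apply sum_eq. intros; ring.
Qed.

(** * Monotonicity and convexity in [mu] *)

(** The domain [[0, 1)] is the range of [mu] on which [dml] is handled. The three conditions are
    bundled because together they are stable under products, as the renewal equation demands. *)
Definition decr_convex (F : R -> R) : Prop :=
  (forall x, 0 <= x < 1 -> 0 <= F x) /\
  (forall x y, 0 <= x -> x <= y -> y < 1 -> F y <= F x) /\
  (forall x y s, 0 <= x < 1 -> 0 <= y < 1 -> 0 <= s <= 1 ->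
    F (s * x + (1 - s) * y) <= s * F x + (1 - s) * F y).

Lemma convex_comb_unit (x y s : R) : 0 <= x < 1 -> 0 <= y < 1 -> 0 <= s <= 1 ->
  0 <= s * x + (1 - s) * y < 1.
Proof.
  intros Hx Hy Hs. split; [nra |].
  assert (0 <= s * (1 - x)) by nra. assert (0 <= (1 - s) * (1 - y)) by nra.
  destruct (Rle_dec s (/ 2)); nra.
Qed.

Lemma decr_convex_ext (F G : R -> R) :
  (forall x, 0 <= x < 1 -> F x = G x) -> decr_convex F -> decr_convex G.
Proof.
  intros H (H1 & H2 & H3). repeat split.
  - intros x Hx. rewrite <- H by easy. now apply H1.
  - intros x y Hx Hxy Hy. rewrite <- !H by lra. now apply H2.
  - intros x y s Hx Hy Hs. rewrite <- !H by (try easy; now apply convex_comb_unit). now apply H3.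
Qed.

Lemma decr_convex_scal (w : R) (F : R -> R) :
  0 <= w -> decr_convex F -> decr_convex (fun x => w * F x).
Proof.
  intros Hw (H1 & H2 & H3). repeat split.
  - intros x Hx. apply Rmult_le_pos; [easy | now apply H1].
  - intros x y Hx Hxy Hy. apply Rmult_le_compat_l; [easy | now apply H2].
  - intros x y s Hx Hy Hs. specialize (H3 x y s Hx Hy Hs). nra.
Qed.

Lemma decr_convex_plus (F G : R -> R) :
  decr_convex F -> decr_convex G -> decr_convex (fun x => F x + G x).
Proof.
  intros (H1 & H2 & H3) (K1 & K2 & K3). repeat split.
  - intros x Hx. specialize (H1 x Hx). specialize (K1 x Hx). lra.
  - intros x y Hx Hxy Hy. specialize (H2 x y Hx Hxy Hy). specialize (K2 x y Hx Hxy Hy). lra.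
  - intros x y s Hx Hy Hs. specialize (H3 x y s Hx Hy Hs).
    specialize (K3 x y s Hx Hy Hs). lra.
Qed.

Lemma decr_convex_mult (F G : R -> R) :
  decr_convex F -> decr_convex G -> decr_convex (fun x => F x * G x).
Proof.
  intros (H1 & H2 & H3) (K1 & K2 & K3). repeat split.
  - intros x Hx. apply Rmult_le_pos; [now apply H1 | now apply K1].
  - intros x y Hx Hxy Hy.
    apply Rmult_le_compat; [apply H1; lra | apply K1; lra | now apply H2 | now apply K2].
  - intros x y s Hx Hy Hs.
    assert (Hc : 0 <= s * x + (1 - s) * y < 1) by now apply convex_comb_unit.
    apply Rle_trans with ((s * F x + (1 - s) * F y) * (s * G x + (1 - s) * G y)).
    + apply Rmult_le_compat; [now apply H1 | now apply K1 | now apply H3 | now apply K3].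
    (* The product of the two averages differs from the average of the products by [- s * (1 - s) *
       (F x - F y) * (G x - G y)]; both factors have the same sign since [F] and [G] decrease. *)
    + assert (Hd : 0 <= (F x - F y) * (G x - G y)).
      { destruct (Rle_dec x y) as [Hxy | Hxy].
        - assert (F y <= F x) by (apply H2; lra).
          assert (G y <= G x) by (apply K2; lra). nra.
        - assert (F x <= F y) by (apply H2; lra).
          assert (G x <= G y) by (apply K2; lra). nra. }
      assert (0 <= s * (1 - s)) by nra. nra.
Qed.

Lemma decr_convex_inv : decr_convex (fun x => / (1 + x)).
Proof.
  repeat split.
  - intros x Hx. left. apply Rinv_0_lt_compat. lra.
  - intros x y Hx Hxy Hy. apply Rinv_le_contravar; lra.
  - intros x y s Hx Hy Hs.
    assert (Hc : 0 <= s * x + (1 - s) * y < 1) by now apply convex_comb_unit.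
    apply Rmult_le_reg_r with ((1 + (s * x + (1 - s) * y)) * ((1 + x) * (1 + y))).
    + repeat apply Rmult_lt_0_compat; lra.
    + apply Rle_trans with ((1 + x) * (1 + y)); [right; field; lra |].
      apply Rle_trans with ((s * (1 + y) + (1 - s) * (1 + x)) * (1 + (s * x + (1 - s) * y)));
        [| right; field; lra].
      (* With denominators cleared, this is exactly the gap in the convexity inequality. *)
      assert (0 <= s * (1 - s) * (x - y) ^ 2).
      { apply Rmult_le_pos; [nra | apply pow2_ge_0]. }
      nra.
Qed.

Lemma decr_convex_sum (w : nat -> R) (F : nat -> R -> R) (n : nat) :
  (forall j, (j <= n)%nat -> 0 <= w j) ->
  (forall j, (j <= n)%nat -> decr_convex (F j)) ->
  decr_convex (fun x => sum_f_R0 (fun j => w j * F j x) n).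
Proof.
  induction n as [| n IH]; intros Hw HF.
  - apply decr_convex_scal; auto.
  - apply decr_convex_plus; [apply IH; auto | apply decr_convex_scal; auto].
Qed.

Lemma decr_convex_dml_alpha (a : R) (n : nat) : 0 < a < 1 ->
  decr_convex (fun mu => dml a mu a n).
Proof.
  intros Ha.
  (* The renewal equation involves all earlier indices, so the induction carries all [j <= n]. *)
  enough (H : forall j, (j <= n)%nat -> decr_convex (fun mu => dml a mu a j)) by now apply H.
  induction n as [| n IH]; intros j Hj.
  - replace j with O by lia. eapply decr_convex_ext; [| apply decr_convex_inv].
    intros x Hx. now rewrite dml_alpha_0.
  - destruct (Nat.eq_dec j (S n)) as [-> | Hne]; [| apply IH; lia].
    eapply decr_convex_ext; [intros x Hx; symmetry; now apply dml_alpha_S |].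
    apply decr_convex_mult; [apply decr_convex_inv |].
    apply (decr_convex_sum (fun j => - rbin (S n - j) (- a)) (fun j mu => dml a mu a j)).
    + intros i Hi. replace (S n - i)%nat with (S (n - i)) by lia.
      pose proof (rbin_opp_nonpos (n - i) a). lra.
    + exact IH.
Qed.

(** For [a < 1] the weights are positive, so the properties found for [c = a] pass to [c = 1]. *)
Lemma dml_1_conv (a mu : R) (n : nat) : 0 <= mu < 1 ->
  dml a mu 1 n = sum_f_R0 (fun j => rbin (n - j) (1 - a) * dml a mu a j) n.
Proof.
  intros Hmu. rewrite dml_conv by easy. f_equal. ring.
Qed.

Lemma decr_convex_dml_1 (a : R) (n : nat) : 0 < a < 1 ->
  decr_convex (fun mu => dml a mu 1 n).
Proof.
  intros Ha. eapply decr_convex_ext; [intros x Hx; symmetry; now apply dml_1_conv |].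
  apply (decr_convex_sum (fun j => rbin (n - j) (1 - a)) (fun j mu => dml a mu a j)).
  - intros j _. left. apply rbin_pos. lra.
  - intros j _. now apply decr_convex_dml_alpha.
Qed.

Lemma dml_alpha_nonneg (a mu : R) (n : nat) : 0 < a < 1 -> 0 <= mu < 1 -> 0 <= dml a mu a n.
Proof. intros Ha Hmu. now apply (decr_convex_dml_alpha a n Ha). Qed.

Lemma dml_1_complement (a mu : R) (n : nat) : 0 <= mu < 1 ->
  1 - dml a mu 1 n = mu * dml a mu (1 + a) n.
Proof. intros Hmu. rewrite (dml_shift a mu 1), rbin_1 by easy. ring. Qed.

(** Both sides are [mu] times sums of the nonnegative [dml a mu a j]: with constant weight
    [rbin n (1 - a)] on the left and the larger weights [rbin (n - j) (1 - a)] on the right. *)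
Lemma dml_1_lower (a mu : R) (n : nat) : 0 < a < 1 -> 0 <= mu < 1 ->
  rbin n (1 - a) * (1 - dml a mu 1 n) <= mu * dml a mu 1 n.
Proof.
  intros Ha Hmu. rewrite dml_1_complement by easy.
  rewrite (Rplus_comm 1 a), <- dml_conv, dml_1_conv by easy.
  rewrite <- Rmult_assoc, (Rmult_comm _ mu), Rmult_assoc.
  apply Rmult_le_compat_l; [easy |]. rewrite scal_sum. apply sum_Rle. intros j Hj.
  rewrite rbin_1, Rmult_1_l, Rmult_comm.
  apply Rmult_le_compat_r; [now apply dml_alpha_nonneg |].
  apply rbin_decr; [lra | lia].
Qed.

(** [1 - dml a mu 1 n] is [mu] times the partial sum of the nonnegative [dml a mu a j], hence grows
    with [n]. *)
Lemma dml_1_decr (a mu : R) (m n : nat) : 0 < a < 1 -> 0 <= mu < 1 -> (m <= n)%nat ->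
  dml a mu 1 n <= dml a mu 1 m.
Proof.
  intros Ha Hmu Hmn. induction Hmn as [| n Hmn IH]; [lra |].
  apply Rle_trans with (dml a mu 1 n); [| easy].
  pose proof (dml_1_complement a mu n Hmu). pose proof (dml_1_complement a mu (S n) Hmu).
  rewrite (Rplus_comm 1 a), <- dml_conv in H, H0 by easy.
  rewrite tech5 in H0.
  replace (sum_f_R0 (fun j => rbin (S n - j) 1 * dml a mu a j) n)
    with (sum_f_R0 (fun j => rbin (n - j) 1 * dml a mu a j) n) in H0
    by (apply sum_eq; intros; now rewrite !rbin_1).
  rewrite rbin_1, Rmult_1_l in H0.
  pose proof (dml_alpha_nonneg a mu (S n) Ha Hmu). nra.
Qed.

(** [dml a mu (1 + a) n] is the convolution of [dml a mu 1] with the positive weights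
    [rbin (n - j) a]. Replacing each [dml a mu 1 j] by the smaller [dml a mu 1 n] leaves the total
    weight [rbin n (1 + a)]. *)
Lemma dml_1_upper (a mu : R) (n : nat) : 0 < a < 1 -> 0 <= mu < 1 ->
  dml a mu 1 n * (1 + mu * rbin n (1 + a)) <= 1.
Proof.
  intros Ha Hmu. pose proof (dml_1_complement a mu n Hmu) as H.
  enough (dml a mu 1 n * rbin n (1 + a) <= dml a mu (1 + a) n) by nra.
  rewrite <- rbin_vandermonde, <- dml_conv, scal_sum by easy.
  apply sum_Rle. intros j Hj. rewrite rbin_1, Rmult_1_r.
  apply Rmult_le_compat_l; [left; apply rbin_pos; lra |].
  now apply dml_1_decr.
Qed.

(** * Passage to the limit *)

Lemma Rabs_Series_le (u M : nat -> R) :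
  (forall k, Rabs (u k) <= M k) -> ex_series M -> Rabs (Series u) <= Series M.
Proof.
  intros Hu HM.
  assert (ex_series (fun k => Rabs (u k))).
  { apply (@ex_series_le R_AbsRing R_CompleteNormedModule _ M); [| easy].
    intros k. change (Rabs (Rabs (u k)) <= M k). now rewrite Rabs_Rabsolu. }
  eapply Rle_trans; [now apply Series_Rabs |]. apply Series_le; [| easy].
  intros k. split; [apply Rabs_pos | apply Hu].
Qed.

Lemma is_lim_seq_sum_f_R0 (u : nat -> nat -> R) (l : nat -> R) (K : nat) :
  (forall k, is_lim_seq (fun n => u n k) (l k)) ->
  is_lim_seq (fun n => sum_f_R0 (u n) K) (sum_f_R0 l K).
Proof.
  intros H. induction K as [| K IH]; [apply H |].
  exact (is_lim_seq_plus' _ _ _ _ IH (H (S K))).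
Qed.

(** Dominated convergence for series: cut at [K] where the tail of [M] is below [eps / 4]; both
    tails and the difference of the heads are then each below [eps / 4]. *)
Lemma tannery (u : nat -> nat -> R) (l M : nat -> R) :
  (forall k, is_lim_seq (fun n => u n k) (l k)) ->
  eventually (fun n => forall k, Rabs (u n k) <= M k) ->
  ex_series M ->
  is_lim_seq (fun n => Series (u n)) (Series l).
Proof.
  intros Hl [N0 HN0] HM.
  assert (HlM : forall k, Rabs (l k) <= M k).
  { intros k. refine (is_lim_seq_le_loc (fun n => Rabs (u n k)) (fun _ => M k)
      (Rabs (l k)) (M k) _ _ _).
    - exists N0. intros n Hn. now apply HN0.
    - exact (is_lim_seq_abs _ (Finite (l k)) (Hl k)).
    - apply is_lim_seq_const. }
  assert (Hex : forall v : nat -> R, (forall k, Rabs (v k) <= M k) -> ex_series v).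
  { intros v Hv. now apply (@ex_series_le R_AbsRing R_CompleteNormedModule _ M). }
  apply is_lim_seq_spec. intros eps.
  assert (He : 0 < eps / 4) by (pose proof (cond_pos eps); lra).
  assert (exists K, Series (fun k => M (S K + k)%nat) < eps / 4) as [K HK].
  { pose proof (proj1 (is_series_Reals _ _) (Series_correct _ HM)) as Hs.
    destruct (Hs (eps / 4) He) as [K HK]. exists K. specialize (HK K (le_n K)).
    rewrite (Series_incr_n M (S K)) in HK by (try lia; easy).
    simpl Init.Nat.pred in HK. unfold Rdist in HK. apply Rabs_def2 in HK. lra. }
  pose proof (is_lim_seq_sum_f_R0 u l K Hl) as Hsum.
  apply is_lim_seq_spec in Hsum. destruct (Hsum (mkposreal _ He)) as [N1 HN1]. simpl in HN1.
  exists (max N0 N1). intros n Hn.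
  specialize (HN0 n ltac:(lia)). specialize (HN1 n ltac:(lia)).
  rewrite (Series_incr_n (u n) (S K)), (Series_incr_n l (S K)) by (try lia; auto).
  simpl Init.Nat.pred.
  assert (HMt : ex_series (fun k => M (S K + k)%nat)) by now apply ex_series_incr_n.
  pose proof (Rabs_Series_le (fun k => u n (S K + k)%nat) _ (fun k => HN0 _) HMt) as T1.
  pose proof (Rabs_Series_le (fun k => l (S K + k)%nat) _ (fun k => HlM _) HMt) as T2.
  apply Rabs_def2 in HN1.
  apply Rabs_le_between in T1. apply Rabs_le_between in T2.
  apply Rabs_def1; lra.
Qed.

(** Put [y = k * a] and [L = x ^ (1 / a)], so [x ^ k = L ^ y]. If [y >= 8 e L] and [N >= 4 e L],
    then [L * (2 + y / N) <= y / (2 e)], and [Gamma_lower] bounds the term by [e * (1/2) ^ y], which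
    is geometric in [k]. *)
Lemma ex_series_Gamma_majorant (a x N : R) : 0 < a -> 0 < x ->
  4 * exp 1 * Rpower x (/ a) <= N ->
  ex_series (fun k => x ^ k * (Rpower (2 + INR k * a / N) (INR k * a) / Gamma (INR k * a + 1))).
Proof.
  intros Ha Hx HN. set (L := Rpower x (/ a)) in *.
  assert (HL : 0 < L) by apply Rpower_pos.
  assert (He : 0 < exp 1) by apply exp_pos.
  assert (HeL : 0 < exp 1 * L) by now apply Rmult_lt_0_compat.
  assert (HN0 : 0 < N) by lra.
  destruct (INR_unbounded (8 * (exp 1 * L) / a)) as [K HK].
  apply (ex_series_incr_n _ K).
  apply (@ex_series_le R_AbsRing R_CompleteNormedModule _
    (fun k => exp 1 * (Rpower (/ 2) a) ^ (K + k))).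
  - intros k.
    set (y := INR (K + k) * a).
    assert (Hy : 8 * (exp 1 * L) <= y).
    { unfold y. assert (INR K <= INR (K + k)) by (apply le_INR; lia).
      apply Rle_trans with (INR K * a); [| nra].
      apply Rmult_le_reg_r with (/ a); [now apply Rinv_0_lt_compat |].
      rewrite (Rmult_assoc (INR K)), Rinv_r by lra. unfold Rdiv in HK. lra. }
    pose proof (Gamma_lower y ltac:(lra)) as HG.
    assert (Hxk : x ^ (K + k) = Rpower L y).
    { rewrite <- Rpower_pow by easy. unfold L, y. rewrite Rpower_mult. f_equal. field. lra. }
    assert (Hgk : (Rpower (/ 2) a) ^ (K + k) = Rpower (/ 2) y).
    { rewrite <- Rpower_pow by apply Rpower_pos. rewrite Rpower_mult. unfold y.
      now rewrite (Rmult_comm a). }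
    assert (Hyn : 0 < y / N) by (apply Rdiv_lt_0_compat; lra).
    change (Rabs (x ^ (K + k) * (Rpower (2 + y / N) y / Gamma (y + 1)))
      <= exp 1 * Rpower (/ 2) a ^ (K + k)).
    pose proof (Gamma_pos (y + 1) ltac:(lra)) as Hg.
    rewrite Hxk, Hgk, Rabs_pos_eq.
    2:{ apply Rmult_le_pos; [left; apply Rpower_pos |].
        apply Rdiv_le_0_compat; [left; apply Rpower_pos | easy]. }
    apply Rmult_le_reg_r with (Gamma (y + 1)); [easy |].
    apply Rle_trans with (Rpower L y * Rpower (2 + y / N) y); [right; field; lra |].
    apply Rle_trans with (exp 1 * Rpower (/ 2) y * (exp (- 1) * Rpower (y * exp (- 1)) y)).
    2:{ apply Rmult_le_compat_l; [| easy].
        apply Rmult_le_pos; [lra | left; apply Rpower_pos]. }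
    replace (exp 1 * Rpower (/ 2) y * (exp (- 1) * Rpower (y * exp (- 1)) y))
      with ((exp 1 * exp (- 1)) * (Rpower (/ 2) y * Rpower (y * exp (- 1)) y)) by ring.
    pose proof (exp_pos (- 1)) as Hem.
    assert (Hee : exp 1 * exp (- 1) = 1) by (rewrite <- exp_plus, Rplus_opp_r; apply exp_0).
    rewrite Hee, Rmult_1_l, !Rpower_mult_distr by (try apply Rmult_lt_0_compat; lra).
    apply Rle_Rpower_l; [lra |]. split; [apply Rmult_lt_0_compat; lra |].
    apply Rmult_le_reg_r with (exp 1); [easy |].
    replace (/ 2 * (y * exp (- 1)) * exp 1) with (/ 2 * y * (exp 1 * exp (- 1))) by ring.
    rewrite Hee.
    assert (y / N * (4 * (exp 1 * L)) <= y).
    { apply Rle_trans with (y / N * N); [apply Rmult_le_compat_l; lra | right; field; lra]. }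
    nra.
  - apply (ex_series_incr_n (fun k => exp 1 * Rpower (/ 2) a ^ k) K).
    apply (ex_series_scal (V := R_NormedModule) (exp 1)), ex_series_geom.
    rewrite Rabs_pos_eq by (left; apply Rpower_pos).
    unfold Rpower. rewrite <- exp_0. apply exp_increasing.
    assert (ln (/ 2) < 0) by (rewrite <- ln_1; apply ln_increasing; lra). nra.
Qed.

(** The power of [n] in [mu ^ k] is exactly the one that normalises [rbin n (k * a + 1)], so each
    term converges to that of [ML]; [tannery] exchanges limit and sum. *)
Lemma dml_1_limit (a x : R) : 0 < a -> 0 < x ->
  is_lim_seq (fun n => dml a (x * Rpower (INR n) (- a)) 1 n) (ML a 1 (- x)).
Proof.
  intros Ha Hx.
  destruct (INR_unbounded (4 * exp 1 * Rpower x (/ a))) as [N HN].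
  assert (HN0 : 0 < INR N).
  { apply Rlt_trans with (4 * exp 1 * Rpower x (/ a)); [| easy].
    pose proof (exp_pos 1). pose proof (Rpower_pos x (/ a)). nra. }
  assert (Hterm : forall n k, (0 < n)%nat ->
    (- (x * Rpower (INR n) (- a))) ^ k * rbin n (INR k * a + 1) =
    (- x) ^ k * (rbin n (INR k * a + 1) * Rpower (INR n) (- (INR k * a)))).
  { intros n k Hn.
    replace (- (x * Rpower (INR n) (- a))) with (- x * Rpower (INR n) (- a)) by ring.
    rewrite Rpow_mult_distr, <- (Rpower_pow k (Rpower _ _)) by apply Rpower_pos.
    rewrite Rpower_mult. replace (- a * INR k) with (- (INR k * a)) by ring. ring. }
  apply (tannery _ _ (fun k => x ^ k *
    (Rpower (2 + INR k * a / INR N) (INR k * a) / Gamma (INR k * a + 1)))).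
  - intros k. apply is_lim_seq_ext_loc with
      (fun n => (- x) ^ k * (rbin n (INR k * a + 1) * Rpower (INR n) (- (INR k * a)))).
    + exists 1%nat. intros n Hn. symmetry. apply Hterm. lia.
    + apply (is_lim_seq_scal_l _ ((- x) ^ k) (/ Gamma (INR k * a + 1))).
      apply rbin_scaled_limit. pose proof (pos_INR k). nra.
  (* For [n >= max 1 N] the base [(n + 1 + y) / n] in [rbin_scaled_le] is at most [2 + y / N], a
     bound free of [n]. *)
  - exists (max 1 N). intros n Hn k. rewrite Hterm by lia.
    assert (Hy : 0 <= INR k * a) by (pose proof (pos_INR k); nra).
    set (y := INR k * a) in *.
    assert (HNn : INR N <= INR n) by (apply le_INR; lia).
    assert (H1n : 1 <= INR n) by (apply (le_INR 1); lia).
    pose proof (Gamma_pos (y + 1) ltac:(lra)) as Hg.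
    pose proof (rbin_pos n (y + 1) ltac:(lra)) as Hr.
    rewrite Rabs_mult, <- RPow_abs, Rabs_Ropp, (Rabs_pos_eq x) by lra.
    apply Rmult_le_compat_l; [apply pow_le; lra |].
    rewrite Rabs_pos_eq by (apply Rmult_le_pos; [lra | left; apply Rpower_pos]).
    eapply Rle_trans; [apply rbin_scaled_le; [lia | easy] |].
    apply Rmult_le_compat_r; [left; now apply Rinv_0_lt_compat |].
    apply Rle_Rpower_l; [easy |]. split; [apply Rdiv_lt_0_compat; lra |].
    assert (Hi : 1 / INR n <= 1).
    { apply Rmult_le_reg_r with (INR n); [lra |]. field_simplify; lra. }
    assert (Hyi : y / INR n <= y / INR N).
    { apply Rmult_le_compat_l; [easy | apply Rinv_le_contravar; lra]. }
    replace ((INR n + 1 + y) / INR n) with (1 + 1 / INR n + y / INR n) by (field; lra).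
    lra.
  - apply ex_series_Gamma_majorant; [easy | easy | lra].
Qed.

(** * Bounds and convexity of [ML] on the negative axis *)

Lemma eventually_scaled_lt_1 (a x : R) : 0 < a -> 0 < x ->
  eventually (fun n => 0 <= x * Rpower (INR n) (- a) < 1).
Proof.
  intros Ha Hx. destruct (INR_unbounded (Rpower x (/ a))) as [N HN].
  exists N. intros n Hn. apply le_INR in Hn.
  pose proof (Rpower_pos x (/ a)).
  split; [apply Rmult_le_pos; [lra | left; apply Rpower_pos] |].
  assert (Hlt : x < Rpower (INR n) a).
  { apply Rle_lt_trans with (Rpower (Rpower x (/ a)) a).
    - rewrite Rpower_mult, Rinv_l, Rpower_1 by lra. lra.
    - apply Rlt_Rpower_l; lra. }
  rewrite Rpower_Ropp. pose proof (Rpower_pos (INR n) a).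
  apply Rmult_lt_reg_r with (Rpower (INR n) a); [easy |].
  rewrite Rmult_assoc, Rinv_l by lra. lra.
Qed.

Lemma ML_nonneg (a x : R) : 0 < a < 1 -> 0 < x -> 0 <= ML a 1 (- x).
Proof.
  intros Ha Hx.
  refine (is_lim_seq_le_loc (fun _ => 0) _ 0 (ML a 1 (- x)) _ _
    (dml_1_limit a x (proj1 Ha) Hx)); [| apply is_lim_seq_const].
  generalize (eventually_scaled_lt_1 a x (proj1 Ha) Hx). apply filter_imp.
  intros n Hn. now apply (decr_convex_dml_1 a n Ha).
Qed.

Lemma ML_convex (a x y s : R) : 0 < a < 1 -> 0 < x -> 0 < y -> 0 <= s <= 1 ->
  ML a 1 (- (s * x + (1 - s) * y)) <= s * ML a 1 (- x) + (1 - s) * ML a 1 (- y).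
Proof.
  intros Ha Hx Hy Hs.
  assert (Hz : 0 < s * x + (1 - s) * y).
  { destruct (Rle_dec s (/ 2)); nra. }
  refine (is_lim_seq_le_loc _
    (fun n => s * dml a (x * Rpower (INR n) (- a)) 1 n +
              (1 - s) * dml a (y * Rpower (INR n) (- a)) 1 n)
    (ML a 1 (- (s * x + (1 - s) * y))) (s * ML a 1 (- x) + (1 - s) * ML a 1 (- y))
    _ (dml_1_limit a _ (proj1 Ha) Hz) _).
  - generalize (filter_and _ _ (eventually_scaled_lt_1 a x (proj1 Ha) Hx)
      (eventually_scaled_lt_1 a y (proj1 Ha) Hy)). apply filter_imp.
    intros n [Hnx Hny].
    replace ((s * x + (1 - s) * y) * Rpower (INR n) (- a))
      with (s * (x * Rpower (INR n) (- a)) + (1 - s) * (y * Rpower (INR n) (- a))) by ring.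
    now apply (decr_convex_dml_1 a n Ha).
  - apply is_lim_seq_plus'.
    + exact (is_lim_seq_scal_l _ s _ (dml_1_limit a x (proj1 Ha) Hx)).
    + exact (is_lim_seq_scal_l _ (1 - s) _ (dml_1_limit a y (proj1 Ha) Hy)).
Qed.

(** Limit of [dml_1_lower] multiplied by [n ^ a], which turns [mu = x * n ^ (- a)] into [x]. *)
Lemma ML_lower (a x : R) : 0 < a < 1 -> 0 < x ->
  (1 - a) / Gamma (2 - a) * (1 - ML a 1 (- x)) <= x * ML a 1 (- x).
Proof.
  intros Ha Hx. pose proof (dml_1_limit a x (proj1 Ha) Hx) as Hl.
  refine (is_lim_seq_le_loc
    (fun n => rbin n (1 - a) * Rpower (INR n) a *
              (1 - dml a (x * Rpower (INR n) (- a)) 1 n))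
    (fun n => x * dml a (x * Rpower (INR n) (- a)) 1 n)
    ((1 - a) / Gamma (2 - a) * (1 - ML a 1 (- x))) (x * ML a 1 (- x)) _ _ _).
  - generalize (eventually_scaled_lt_1 a x (proj1 Ha) Hx). apply filter_imp.
    intros n Hn. pose proof (dml_1_lower a _ n Ha Hn) as H.
    pose proof (Rpower_pos (INR n) a) as Hp.
    apply Rmult_le_compat_l with (r := Rpower (INR n) a) in H; [| lra].
    rewrite <- !Rmult_assoc in H. rewrite Rpower_Ropp in *.
    rewrite (Rmult_comm (rbin n (1 - a))).
    eapply Rle_trans; [exact H |]. right. field. lra.
  - apply is_lim_seq_mult'; [now apply rbin_1_opp_scaled_limit |].
    apply is_lim_seq_minus'; [apply is_lim_seq_const | exact Hl].
  - exact (is_lim_seq_scal_l _ x _ Hl).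
Qed.

Lemma ML_upper (a x : R) : 0 < a < 1 -> 0 < x ->
  ML a 1 (- x) * (1 + x * / Gamma (a + 1)) <= 1.
Proof.
  intros Ha Hx. pose proof (dml_1_limit a x (proj1 Ha) Hx) as Hl.
  refine (is_lim_seq_le_loc
    (fun n => dml a (x * Rpower (INR n) (- a)) 1 n *
              (1 + x * (rbin n (a + 1) * Rpower (INR n) (- a)))) (fun _ => 1)
    (ML a 1 (- x) * (1 + x * / Gamma (a + 1))) 1 _ _ _).
  - generalize (eventually_scaled_lt_1 a x (proj1 Ha) Hx). apply filter_imp.
    intros n Hn. pose proof (dml_1_upper a _ n Ha Hn) as H.
    eapply Rle_trans; [| exact H]. rewrite (Rplus_comm 1 a). right. ring.
  - apply is_lim_seq_mult'; [exact Hl |].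
    apply is_lim_seq_plus'; [apply is_lim_seq_const |].
    apply (is_lim_seq_scal_l _ x (/ Gamma (a + 1))). apply rbin_scaled_limit. lra.
  - apply is_lim_seq_const.
Qed.

(** If the value were zero, [ML_lower] would put a positive constant below zero. *)
Lemma ML_pos (a x : R) : 0 < a < 1 -> 0 < x -> 0 < ML a 1 (- x).
Proof.
  intros Ha Hx. destruct (ML_nonneg a x Ha Hx) as [H | H]; [easy | exfalso].
  pose proof (ML_lower a x Ha Hx) as HL. rewrite <- H in HL.
  assert (0 < (1 - a) / Gamma (2 - a)).
  { apply Rdiv_lt_0_compat; [lra | apply Gamma_pos; lra]. }
  lra.
Qed.

Lemma ML_mul_le (a x : R) : 0 < a < 1 -> 0 < x -> x * ML a 1 (- x) <= Gamma (a + 1).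
Proof.
  intros Ha Hx. pose proof (ML_upper a x Ha Hx) as H. pose proof (ML_nonneg a x Ha Hx).
  pose proof (Gamma_pos (a + 1) ltac:(lra)) as Hg.
  apply Rmult_le_reg_r with (/ Gamma (a + 1)); [now apply Rinv_0_lt_compat |].
  rewrite Rinv_r by lra. nra.
Qed.

Lemma ML_mul_ge (a : R) : 0 < a < 1 ->
  exists c X, 0 < c /\ 0 < X /\ forall x, X <= x -> c <= x * ML a 1 (- x).
Proof.
  intros Ha. pose proof (Gamma_pos (a + 1) ltac:(lra)) as Hg.
  pose proof (Gamma_pos (2 - a) ltac:(lra)) as Hg2.
  set (c := (1 - a) / Gamma (2 - a)).
  assert (Hc : 0 < c) by (apply Rdiv_lt_0_compat; lra).
  (* Beyond this threshold [ML_mul_le] forces [ML a 1 (- x) <= 1/2], so [ML_lower] leaves at least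
     [c / 2]. *)
  exists (c / 2), (2 * Gamma (a + 1)). repeat split; [lra | lra |].
  intros x Hx. pose proof (ML_lower a x Ha ltac:(lra)) as HL. fold c in HL.
  pose proof (ML_mul_le a x Ha ltac:(lra)) as HU. pose proof (ML_nonneg a x Ha ltac:(lra)).
  assert (ML a 1 (- x) <= / 2) by nra. nra.
Qed.

(* The chord slope of the convex function [x |-> ML a 1 (- x)] over [[p x, q x]] is compared
   with the one over [[q x, k x]], [k] being so large that the upper bound [C / (k x)] is
   negligible against the lower bound [c / (q x)]. *)
Lemma ML_diff_lower (a p q : R) : 0 < a < 1 -> 0 < p -> p < q ->
  exists c X, 0 < c /\ 0 < X /\
    forall x, X <= x -> c <= x * (ML a 1 (- (p * x)) - ML a 1 (- (q * x))).
Proof.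
  intros Ha Hp Hpq. destruct (ML_mul_ge a Ha) as (c & X & Hc & HX & Hlow).
  pose proof (Gamma_pos (a + 1) ltac:(lra)) as Hg. set (C := Gamma (a + 1)) in *.
  (* The second summand gives [C / k <= c / (2 * q)], half of the lower bound [c / q] available at
     [q * x]. *)
  set (k := q + 2 * q * C / c).
  assert (HC : 0 < 2 * q * C / c).
  { apply Rdiv_lt_0_compat; [| easy]. repeat apply Rmult_lt_0_compat; lra. }
  assert (Hkq : q < k) by (unfold k; lra).
  (* The weight for which [s * p + (1 - s) * k = q]. *)
  set (s := (k - q) / (k - p)).
  assert (Hs : 0 < s < 1).
  { unfold s. split; [apply Rdiv_lt_0_compat; lra |].
    apply Rmult_lt_reg_r with (k - p); [lra |]. field_simplify; lra. }
  exists ((1 - s) * (c / (2 * q))), (X / q). repeat split.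
  - apply Rmult_lt_0_compat; [lra | apply Rdiv_lt_0_compat; lra].
  - apply Rdiv_lt_0_compat; lra.
  - intros x Hx.
    assert (Hqx : X <= q * x).
    { apply Rmult_le_reg_r with (/ q); [apply Rinv_0_lt_compat; lra |].
      apply Rle_trans with x; [exact Hx | right; field; lra]. }
    assert (Hx0 : 0 < x) by nra.
    assert (Hk0 : 0 < k * x) by (apply Rmult_lt_0_compat; lra).
    pose proof (Hlow _ Hqx) as H1.
    pose proof (ML_mul_le a (k * x) Ha Hk0) as H2. fold C in H2.
    pose proof (ML_convex a (p * x) (k * x) s Ha ltac:(nra) Hk0 ltac:(lra)) as H3.
    replace (s * (p * x) + (1 - s) * (k * x)) with (q * x) in H3
      by (unfold s; field; lra).
    set (fp := ML a 1 (- (p * x))) in *. set (fq := ML a 1 (- (q * x))) in *.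
    set (fk := ML a 1 (- (k * x))) in *.
    assert (H4 : c / q <= x * fq).
    { apply Rmult_le_reg_l with q; [lra |].
      apply Rle_trans with c; [right; field; lra | lra]. }
    assert (H5 : x * fk <= c / (2 * q)).
    { apply Rle_trans with (C / k).
      - apply Rmult_le_reg_l with k; [lra |].
        apply Rle_trans with C; [lra | right; field; lra].
      - apply Rmult_le_reg_r with k; [lra |].
        apply Rle_trans with C; [right; field; lra |].
        apply Rle_trans with (c / (2 * q) * (2 * q * C / c)); [right; field; lra |].
        apply Rmult_le_compat_l; [left; apply Rdiv_lt_0_compat; lra | unfold k; lra]. }
    assert (H6 : c / q = 2 * (c / (2 * q))) by (field; lra).
    assert (H7 : (1 - s) * (x * fq - x * fk) <= s * (x * (fp - fq))) by nra.
    assert (H8 : (1 - s) * (c / (2 * q)) <= (1 - s) * (x * fq - x * fk)).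
    { apply Rmult_le_compat_l; lra. }
    (* Positivity of the lower bound allows the factor [s < 1] in [H7] to be dropped. *)
    assert (0 < (1 - s) * (c / (2 * q))).
    { apply Rmult_lt_0_compat; [lra | apply Rdiv_lt_0_compat; lra]. }
    nra.
Qed.

(** * Comparison of two final states *)

Lemma dirichlet_spectrum_pos (lam : nat -> R) (n : nat) : dirichlet_spectrum lam -> 0 < lam n.
Proof.
  intros (H0 & Hm & _). induction n as [| n IH]; [easy |]. specialize (Hm n). lra.
Qed.

(** For large [n] the equality of states yields [c * |f n| <= C / p * lam n * (|u0 n| + |u0' n|)].
    The single factor [lam n] accounts for the shift from [g] to [g + 1], and the decay of the
    initial data puts [f] into [in_S lam g]. *)
Lemma solP_time_not_lt (alpha : R) (lam : nat -> R) (g : R) (f u0 u0' : nat -> R) (T T' : R) :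
  0 < alpha < 1 -> dirichlet_spectrum lam -> 0 < T -> T < T' ->
  in_Hdot_m2 lam f -> ~ in_S lam g f ->
  in_S lam (g + 1) u0 -> in_S lam (g + 1) u0' ->
  (forall n, solP alpha lam u0 f T n = solP alpha lam u0' f T' n) -> False.
Proof.
  intros Ha Hlam HT HTT' Hf HnS [_ Hu] [_ Hu'] Heq. apply HnS. split; [exact Hf |].
  set (p := Rpower T alpha) in *. set (q := Rpower T' alpha) in *.
  assert (Hp : 0 < p) by apply Rpower_pos.
  assert (Hpq : p < q) by (apply Rlt_Rpower_l; lra).
  destruct (ML_diff_lower alpha p q Ha Hp Hpq) as (c & X & Hc & HX & Hlow).
  set (C := Gamma (alpha + 1)).
  assert (HC : 0 < C) by (apply Gamma_pos; lra).
  apply (is_lim_seq_le_le_loc (fun _ => 0) _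
    (fun n => C / p / c * (Rpower (lam n) (g + 1) * Rabs (u0 n) +
                           Rpower (lam n) (g + 1) * Rabs (u0' n)))).
  - destruct Hlam as (Hl0 & Hl1 & Hl2).
    pose proof (proj2 (is_lim_seq_spec _ _) Hl2 X) as HX'.
    revert HX'. apply filter_imp. intros n HXn.
    assert (Hl : 0 < lam n) by lra.
    pose proof (Rpower_pos (lam n) g) as Hpow.
    split; [apply Rmult_le_pos; [lra | apply Rabs_pos] |].
    specialize (Hlow (lam n) ltac:(lra)). specialize (Heq n).
    unfold solP in Heq. fold p q in Heq.
    replace (- lam n * p) with (- (p * lam n)) in Heq by ring.
    replace (- lam n * q) with (- (q * lam n)) in Heq by ring.
    pose proof (ML_mul_le alpha (p * lam n) Ha ltac:(nra)) as Ep.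
    pose proof (ML_mul_le alpha (q * lam n) Ha ltac:(nra)) as Eq. fold C in Ep, Eq.
    pose proof (ML_nonneg alpha (p * lam n) Ha ltac:(nra)) as Np.
    pose proof (ML_nonneg alpha (q * lam n) Ha ltac:(nra)) as Nq.
    set (ep' := ML alpha 1 (- (p * lam n))) in *. set (eq' := ML alpha 1 (- (q * lam n))) in *.
    assert (Ep' : lam n * ep' <= C / p).
    { apply Rmult_le_reg_l with p; [lra |]. apply Rle_trans with C; [lra | right; field; lra]. }
    (* The bound [C / q] is weakened to [C / p], as [p < q], to share one constant. *)
    assert (Eq' : lam n * eq' <= C / p).
    { apply Rmult_le_reg_l with p; [lra |]. apply Rle_trans with C; [| right; field; lra].
      assert (0 <= lam n * eq') by nra. nra. }
    (* The equality of states times [lam n ^ 2], so that each Mittag-Leffler value is paired with a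
       factor [lam n]; the source terms free of [ML] cancel. *)
    assert (Hid : lam n * (ep' - eq') * f n = lam n * (lam n * ep' * u0 n - lam n * eq' * u0' n)).
    { apply Rmult_eq_reg_l with (/ (lam n) ^ 2);
        [| apply Rinv_neq_0_compat, pow_nonzero; lra].
      transitivity (/ lam n * (ep' - eq') * f n); [field; lra |].
      transitivity (ep' * u0 n - eq' * u0' n); [lra | field; lra]. }
    assert (Habs : c * Rabs (f n) <= C / p * (lam n * (Rabs (u0 n) + Rabs (u0' n)))).
    { apply Rle_trans with (Rabs (lam n * (ep' - eq') * f n)).
      - rewrite Rabs_mult. apply Rmult_le_compat_r; [apply Rabs_pos |].
        eapply Rle_trans; [exact Hlow | apply Rle_abs].
      - rewrite Hid, Rabs_mult, (Rabs_pos_eq (lam n)) by lra.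
        replace (C / p * (lam n * (Rabs (u0 n) + Rabs (u0' n))))
          with (lam n * (C / p * Rabs (u0 n) + C / p * Rabs (u0' n))) by ring.
        apply Rmult_le_compat_l; [lra |]. unfold Rminus.
        eapply Rle_trans; [apply Rabs_triang |]. rewrite Rabs_Ropp.
        rewrite (Rabs_mult (lam n * ep')), (Rabs_mult (lam n * eq')).
        rewrite (Rabs_pos_eq (lam n * ep')), (Rabs_pos_eq (lam n * eq')) by nra.
        apply Rplus_le_compat; apply Rmult_le_compat_r; try apply Rabs_pos; easy. }
    rewrite Rpower_plus, Rpower_1 by easy.
    apply Rmult_le_reg_l with c; [easy |].
    replace (c * (C / p / c * (Rpower (lam n) g * lam n * Rabs (u0 n) +
                               Rpower (lam n) g * lam n * Rabs (u0' n))))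
      with (Rpower (lam n) g * (C / p * (lam n * (Rabs (u0 n) + Rabs (u0' n)))))
      by (field; lra).
    replace (c * (Rpower (lam n) g * Rabs (f n)))
      with (Rpower (lam n) g * (c * Rabs (f n))) by ring.
    apply Rmult_le_compat_l; lra.
  - apply is_lim_seq_const.
  - replace (Finite 0) with (Rbar_mult (C / p / c) (0 + 0)) by (simpl; f_equal; ring).
    apply is_lim_seq_scal_l. now apply is_lim_seq_plus'.
Qed.

Theorem mainTheorem1 (alpha : R) (lam : nat -> R) (g : R) (f u0 u0' : nat -> R) (T T' : R) :
  0 < alpha < 1 ->
  dirichlet_spectrum lam ->
  0 <= g ->
  in_Hdot_m2 lam f -> ~ in_S lam g f ->
  0 < T -> 0 < T' ->
  in_L2 u0 -> in_S lam (g + 1) u0 ->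
  in_L2 u0' -> in_S lam (g + 1) u0' ->
  (forall n, solP alpha lam u0 f T n = solP alpha lam u0' f T' n) ->
  T = T' /\ (forall n, u0 n = u0' n).
Proof.
  intros Ha Hlam _ Hf HnS HT HT' _ Hu _ Hu' Heq.
  assert (HTT : T = T').
  { destruct (Rtotal_order T T') as [Hlt | [Ht | Hgt]]; [exfalso | easy | exfalso].
    - exact (solP_time_not_lt alpha lam g f u0 u0' T T' Ha Hlam HT Hlt Hf HnS Hu Hu' Heq).
    (* The hypotheses are symmetric in the two solutions, so they are exchanged. *)
    - exact (solP_time_not_lt alpha lam g f u0' u0 T' T Ha Hlam HT' Hgt Hf HnS Hu' Hu
        (fun n => eq_sym (Heq n))). }
  split; [exact HTT |]. intros n. specialize (Heq n). unfold solP in Heq.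
  rewrite <- HTT in Heq.
  pose proof (dirichlet_spectrum_pos lam n Hlam) as Hl.
  (* At equal times the source terms cancel, and the common positive factor of [u0 n] and [u0' n]
     can be divided out. *)
  pose proof (ML_pos alpha (lam n * Rpower T alpha) Ha
    (Rmult_lt_0_compat _ _ Hl (Rpower_pos T alpha))) as Hpos.
  rewrite Ropp_mult_distr_l in Hpos.
  apply Rmult_eq_reg_l with (ML alpha 1 (- lam n * Rpower T alpha)); lra.
Qed.
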